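(* Let $\mathcal A$ be a unital associative algebra over $\mathbb C$ and let $K_m=K_m^{\mathrm{sh}}$ $(m\ge1)$ be the cumulants associated with the unshuffle spreadability system of $\mathcal A$ (see context). Then, as formal power series in $a_1,\dots,a_n\in\mathcal A$, $$\log(e^{a_1}e^{a_2}\cdots e^{a_n})=\sum\frac1{p_1!p_2!\cdots p_n!}\,K_{p_1+p_2+\cdots+p_n}(\underbrace{a_1,\dots,a_1}_{p_1\text{ times}},\underbrace{a_2,\dots,a_2}_{p_2\text{ times}},\dots,\underbrace{a_n,\dots,a_n}_{p_n\text{ times}}),$$ where the sum runs over all $n$-tuples $(p_1,\dots,p_n)$ of nonnegative integers with the exception of $(0,\dots,0)$. (The formal identity is understood as the identity in $\mathcal A[[z_1,\dots,z_n]]$ obtained by replacing each $a_i$ with $z_ia_i$, where $z_1,\dots,z_n$ are commuting indeterminates.)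
   Context: Ordered set partitions. An ordered set partition of $[m]=\{1,\dots,m\}$ is a sequence $\pi=(P_1,\dots,P_p)$ of pairwise disjoint nonempty blocks with union $[m]$; $\mathcal{OP}_m$ is the set of them; $\hat1_m=([m])$. The quasi-meet of $\pi=(P_1,\dots,P_p)$ and $\sigma=(S_1,\dots,S_s)$ is $\pi\curlywedge\sigma=(P_1\cap S_1,P_1\cap S_2,\dots,P_1\cap S_s,P_2\cap S_1,\dots,P_p\cap S_s)$ with empty sets removed. The ordered kernel $\kappa(i_1,\dots,i_m)\in\mathcal{OP}_m$ has as blocks the level sets $\{k:i_k=v\}$ listed in increasing order of $v$. For $P=\{p_1<\dots<p_k\}$ put $X_P=X_{p_1}\cdots X_{p_k}$. Unshuffle spreadability system. Let $\varphi=\mathrm{Id}:\mathcal A\to\mathcal A$, $\mathcal U=\bigotimes_{i=1}^\infty\mathcal A$ (algebraic infinite tensor product of unital algebras), $\iota^{(j)}(X)=X^{(j)}=1^{\otimes(j-1)}\otimes X\otimes1^{\otimes\infty}$, and $\tilde\varphi:\mathcal U\to\mathcal A$ the linear concatenation map $\tilde\varphi(X_1\otimes\cdots\otimes X_k\otimes1^{\otimes\infty})=X_1\cdots X_k$. For $\pi=(P_1,\dots,P_p)\in\mathcal{OP}_m$, $\varphi_\pi(X_1,\dots,X_m)=\tilde\varphi(X_1^{(i_1)}\cdots X_m^{(i_m)})=X_{P_1}X_{P_2}\cdots X_{P_p}$ for any indices with $\kappa(i_1,\dots,i_m)=\pi$. Cumulants. For $N\in\mathbb N$ put $\varphi_{\hat1_m}(N.X_1,\dots,N.X_m)=\sum_{i_1,\dots,i_m=1}^N\varphi_{\kappa(i_1,\dots,i_m)}(X_1,\dots,X_m)=\tilde\varphi\big((\sum_{i=1}^NX_1^{(i)})\cdots(\sum_{i=1}^NX_m^{(i)})\big)$,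 which is a polynomial in $N$ with coefficients in $\mathcal A$. The cumulant $K_m(X_1,\dots,X_m)$ is the coefficient of $N$ in this polynomial. *)

(* Defs.v *)
From HB Require Import structures.
From mathcomp Require Import all_boot all_order all_algebra.
From mathcomp Require Import boolp classical_sets reals complex mpoly.
Set Implicit Arguments.
Unset Strict Implicit.
Unset Printing Implicit Defensive.

Import GRing.Theory.
Local Open Scope ring_scope.

(* The ring A[[z_1, ..., z_n]] of formal power series in n commuting
   indeterminates over a possibly noncommutative ring A.  A series is its
   family of coefficients: f m is the coefficient of z^m. *)
Definition fps (n : nat) (A : nzRingType) : Type := 'X_{1..n} -> A.

Section FpsRing.
Context {n : nat} {A : nzRingType}.
Implicit Types f g h : fps n A.

HB.instance Definition _ := gen_eqMixin (fps n A).
HB.instance Definition _ := gen_choiceMixin (fps n A).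

Definition fps_zero : fps n A := fun=> 0.
Definition fps_opp f : fps n A := fun m => - f m.
Definition fps_add f g : fps n A := fun m => f m + g m.
Definition fps_one : fps n A := fun m => (m == 0%MM)%:R.
Definition fps_mul f g : fps n A := fun m =>
  \sum_(k : 'X_{1..n < (mdeg m).+1, (mdeg m).+1} | m == (k.1 + k.2)%MM)
    f k.1 * g k.2.

Fact fps_addA : associative fps_add.
Proof. by move=> f g h; apply/funext => m; apply: addrA. Qed.
Fact fps_addC : commutative fps_add.
Proof. by move=> f g; apply/funext => m; apply: addrC. Qed.
Fact fps_add0 : left_id fps_zero fps_add.
Proof. by move=> f; apply/funext => m; apply: add0r. Qed.
Fact fps_addN : left_inverse fps_zero fps_opp fps_add.
Proof. by move=> f; apply/funext => m; apply: addNr. Qed.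

HB.instance Definition _ :=
  GRing.isZmodule.Build (fps n A) fps_addA fps_addC fps_add0 fps_addN.

Let trunc (d : nat) f : {mpoly A[n]} :=
  \sum_(m : 'X_{1..n < d}) f m *: 'X_[m].

Let truncE d f m : (mdeg m < d)%N -> (trunc d f)@_m = f m.
Proof.
move=> md; rewrite /trunc raddf_sum /= (bigD1 (BMultinom md)) //=.
rewrite mcoeffZ mcoeffX eqxx mulr1 big1 ?addr0 // => k neq.
rewrite mcoeffZ mcoeffX; case: eqP => [e|_]; last by rewrite mulr0.
by case/eqP: neq; apply: val_inj.
Qed.

Let fps_mulE d f g m : (mdeg m < d)%N ->
  fps_mul f g m = (trunc d f * trunc d g)@_m.
Proof.
move=> md; rewrite mcoeffM; apply: eq_bigr => k _.
by rewrite !truncE //; apply: leq_trans md; apply: bmdeg.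
Qed.

Let fps_mul_eql d f p g m : (mdeg m < d)%N ->
  (forall k, (mdeg k < d)%N -> f k = p@_k) ->
  fps_mul f g m = (p * trunc d g)@_m.
Proof.
move=> md H; rewrite mcoeffM; apply: eq_bigr => k _.
by rewrite truncE ?H //; apply: leq_trans md; apply: bmdeg.
Qed.

Let fps_mul_eqr d f p g m : (mdeg m < d)%N ->
  (forall k, (mdeg k < d)%N -> f k = p@_k) ->
  fps_mul g f m = (trunc d g * p)@_m.
Proof.
move=> md H; rewrite mcoeffM; apply: eq_bigr => k _.
by rewrite truncE ?H //; apply: leq_trans md; apply: bmdeg.
Qed.

Fact fps_mulA : associative fps_mul.
Proof.
move=> f g h; apply/funext => m; set d := (mdeg m).+1.
rewrite (@fps_mul_eql d (fps_mul f g) (trunc d f * trunc d g)) //; last first.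
  by move=> k; apply: fps_mulE.
rewrite (@fps_mul_eqr d (fps_mul g h) (trunc d g * trunc d h)) ?mulrA //.
by move=> k; apply: fps_mulE.
Qed.

Let fps_oneE k : fps_one k = (1 : {mpoly A[n]})@_k.
Proof. by rewrite mcoeff1. Qed.

Fact fps_mul1f : left_id fps_one fps_mul.
Proof.
move=> f; apply/funext => m; set d := (mdeg m).+1.
by rewrite (@fps_mul_eql d _ 1) // mul1r truncE.
Qed.

Fact fps_mulf1 : right_id fps_one fps_mul.
Proof.
move=> f; apply/funext => m; set d := (mdeg m).+1.
by rewrite (@fps_mul_eqr d _ 1) // mulr1 truncE.
Qed.

Fact fps_mulDl : left_distributive fps_mul fps_add.
Proof.
move=> f g h; apply/funext => m; rewrite /fps_mul /fps_add -big_split /=.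
by apply: eq_bigr => k _; rewrite mulrDl.
Qed.

Fact fps_mulDr : right_distributive fps_mul fps_add.
Proof.
move=> f g h; apply/funext => m; rewrite /fps_mul /fps_add -big_split /=.
by apply: eq_bigr => k _; rewrite mulrDr.
Qed.

Fact fps_one_neq0 : fps_one != 0.
Proof.
apply/eqP => /(congr1 (fun f => f 0%MM)) /eqP.
by rewrite /fps_one eqxx; apply/negP; apply: oner_neq0.
Qed.

HB.instance Definition _ := GRing.Zmodule_isNzRing.Build (fps n A)
  fps_mulA fps_mul1f fps_mulf1 fps_mulDl fps_mulDr fps_one_neq0.

Lemma fps_expr_eq0 f k m : f 0%MM = 0 -> (mdeg m < k)%N -> (f ^+ k) m = 0.
Proof.
move=> f0; elim: k m => [//|k IH] m mk; rewrite exprS.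
apply: big1 => -[x y] /= /eqP e.
have [x0|x0] := eqVneq (x : 'X_{1..n}) 0%MM; first by rewrite x0 f0 mul0r.
have x1 : (0 < mdeg x)%N by rewrite lt0n mdeg_eq0.
rewrite IH ?mulr0 // -ltnS; apply: leq_ltn_trans mk.
by rewrite [X in (_ < X)%N](congr1 mdeg e) mdegD -add1n leq_add2r.
Qed.

End FpsRing.

Section ExpLog.
Context {F : fieldType} {A : algType F} {n : nat}.

Definition fps_monom (a : A) (i : 'I_n) : fps n A :=
  fun m => if m == U_(i)%MM then a else 0.

(* e^f = \sum_k f^k / k!  for f without constant term.  The coefficient of z^m
   only involves k <= |m|, see fps_expr_eq0. *)
Definition fps_exp (f : fps n A) : fps n A := fun m =>
  \sum_(0 <= k < (mdeg m).+1) (k`!%:R^-1 : F) *: (f ^+ k) m.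

(* log f = \sum_(k >= 1) (-1)^(k-1) (f - 1)^k / k  for f with constant term 1;
   the sum is cut at |m| for the same reason. *)
Definition fps_log (f : fps n A) : fps n A := fun m =>
  \sum_(1 <= k < (mdeg m).+1) ((-1) ^+ k.-1 / k%:R : F) *: ((f - 1) ^+ k) m.

End ExpLog.

(* The algebraic infinite tensor product of countably many copies of the unital
   algebra A: the universal unital algebra U equipped with pairwise commuting
   unital homomorphisms iota j : A -> U.  Indices start at 0, so iota j X is
   1^{(x) j} (x) X (x) 1^{(x) oo}, and X_0 (x) ... (x) X_(k-1) (x) 1^{(x) oo}
   is the product of the iota j (X_j). *)
Definition is_infinite_tensor_power (F : fieldType) (A U : algType F)
    (iota : nat -> {lrmorphism A -> U}) : Prop :=
  (forall i j x y, i != j -> GRing.comm (iota i x) (iota j y)) /\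
  (forall (V : algType F) (f : nat -> {lrmorphism A -> V}),
     (forall i j x y, i != j -> GRing.comm (f i x) (f j y)) ->
   exists g : {lrmorphism U -> V},
     (forall j x, g (iota j x) = f j x) /\
     (forall h : {lrmorphism U -> V}, (forall j x, h (iota j x) = f j x) ->
        h =1 g)).

Record unshuffle_system (F : fieldType) (A : algType F) := UnshuffleSystem {
  us_alg : algType F;
  us_iota : nat -> {lrmorphism A -> us_alg};
  us_tensor : is_infinite_tensor_power us_iota;
  us_phi : {linear us_alg -> A};
  us_phi_concat : forall (k : nat) (X : 'I_k -> A),
    us_phi (\prod_(j < k) us_iota j (X j)) = \prod_(j < k) X j
}.

Section Cumulants.
Context {F : fieldType} {A : algType F} (S : unshuffle_system A).

(* \varphi_{\hat 1_m}(N.X_1, ..., N.X_m) *)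
Definition dot_moment (N m : nat) (X : m.-tuple A) : A :=
  us_phi S (\prod_(k < m) \sum_(i < N) us_iota S i (tnth X k)).

(* The polynomial N |-> dot_moment N X; it is unique when F has
   characteristic 0. *)
Definition dot_moment_poly (m : nat) (X : m.-tuple A) : {poly A} :=
  xget 0 [set p : {poly A} | forall N : nat, p.[N%:R] = dot_moment N X]%classic.

Definition cumulant (m : nat) (X : m.-tuple A) : A := (dot_moment_poly X)`_1.

End Cumulants.

Section RepeatedArguments.
Context {T : Type} {n : nat}.

Definition repeat_seq (p : 'X_{1..n}) (a : 'I_n -> T) : seq T :=
  flatten [seq nseq (p i) (a i) | i <- enum 'I_n].

Fact size_repeat_seq (p : 'X_{1..n}) (a : 'I_n -> T) :
  size (repeat_seq p a) == (\sum_(i < n) p i)%N.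
Proof.
rewrite size_flatten /shape -map_comp sumnE big_map -big_enum /=.
by apply/eqP/eq_bigr => i _; rewrite size_nseq.
Qed.

Definition repeat_args (p : 'X_{1..n}) (a : 'I_n -> T) :
    (\sum_(i < n) p i)%N.-tuple T :=
  Tuple (size_repeat_seq p a).

End RepeatedArguments.

(* Main.v *)
Require Import Defs.
From mathcomp Require Import all_boot all_order all_algebra.
From mathcomp Require Import reals complex mpoly.
From mathcomp Require Import boolp classical_sets.
Import GRing.Theory.
Local Open Scope ring_scope.

(** Put [G = e^(z_1 a_1) ... e^(z_n a_n)] in [A[[z_1, ..., z_n]]].  The theorem
    says that the mixed exponential generating series of the cumulants is
    [log G]; it holds because that of the moments of [N] copies is [G ^+ N].

    To see the latter, let [b_i] be the sum of the first [N] copies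
    [iota j (a_i)] of [a_i].  Up to the factor [1 / (p_1! ... p_n!)], the product
    to which the concatenation map is applied in the moment at
    [(a_1, p_1 times), ..., (a_n, p_n times)] is [b_1 ^+ p_1 * ... * b_n ^+ p_n],
    and this is the coefficient of [z^p] in [e^(z_1 b_1) ... e^(z_n b_n)]
    ([fps_oexp_coef]).  Different copies commute, so the exponential of a sum
    splits and the factors can be regrouped by copy ([fps_oexpD]): the series is
    the product over [j < N] of the images of [G] under [iota j].  The
    concatenation map, applied coefficientwise, merges these [N] commuting
    images into [G ^+ N] ([fps_map_concat]).  This is [dot_moment_repeat].

    The dependence on [N] is then read off from Newton's binomial expansion
    [G ^+ N = \sum_k 'C(N, k) (G - 1) ^+ k], where only [k <= |p|] matter at
    [z^p] because [G - 1] has no constant term ([fps_expr_newton]).  As a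
    polynomial in [N], ['C(N, k)] has linear coefficient [(-1)^(k-1) / k] for
    [k >= 1] ([coef1_newton_poly]), which are the coefficients of the logarithm.
    The polynomial is determined by its values at the natural numbers
    ([poly_nat_eq0]), hence is the one that defines the cumulant
    ([cumulant_newton]). *)

Set Implicit Arguments.
Unset Strict Implicit.
Unset Printing Implicit Defensive.

(** * Coefficients of products of power series *)

Section Coefficients.
Context {n : nat} {A : nzRingType}.
Implicit Types (f g : fps n A) (m : 'X_{1..n}).

Lemma fps_coefM f g m : (f * g) m =
  \sum_(k : 'X_{1..n < (mdeg m).+1, (mdeg m).+1} | m == (k.1 + k.2)%MM)
    f k.1 * g k.2.
Proof. by []. Qed.

Lemma fps_coefMn f c m : (f *+ c) m = f m *+ c.
Proof. by elim: c => [//|c IH]; rewrite !mulrS -IH. Qed.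

Lemma fps_coef_sum I (r : seq I) (P : pred I) (f : I -> fps n A) m :
  (\sum_(i <- r | P i) f i) m = \sum_(i <- r | P i) f i m.
Proof. by apply: (big_morph (fun f : fps n A => f m)). Qed.

Definition fps_vanish d f := forall m, (mdeg m < d)%N -> f m = 0.

Lemma fps_vanishM d e f g :
  fps_vanish d f -> fps_vanish e g -> fps_vanish (d + e) (f * g).
Proof.
move=> f0 g0 m md; apply: big1 => -[x y] /= /eqP mE.
have [xd|dx] := ltnP (mdeg x) d; first by rewrite f0 ?mul0r.
rewrite g0 ?mulr0 // -(ltn_add2l (mdeg x)) -mdegD -mE.
by apply: leq_trans md _; rewrite leq_add2r.
Qed.

Lemma fps_vanishX f k : f 0%MM = 0 -> fps_vanish k (f ^+ k).
Proof. by move=> f0 m mk; apply: fps_expr_eq0. Qed.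

Lemma fps_comm f g :
  (forall k l, GRing.comm (f k) (g l)) -> GRing.comm f g.
Proof.
move=> fg; apply/funext => m; rewrite !fps_coefM.
rewrite (reindex_inj (h := fun k => (k.2, k.1))) /=; last first.
  by move=> [? ?] [? ?] [-> ->].
by apply: eq_big => [k|k _]; [rewrite addmC | apply: fg].
Qed.

(** Covers the products below in which supports leave only one way of writing
    [m] as a sum of two exponents. *)
Lemma fps_coefM_unique f g m k0 : (k0 <= m)%MM ->
    (forall k l, m = (k + l)%MM -> k != k0 -> f k * g l = 0) ->
  (f * g) m = f k0 * g (m - k0)%MM.
Proof.
move=> le_m fg0; rewrite fps_coefM.
have d1 : (mdeg k0 < (mdeg m).+1)%N.
  by rewrite ltnS -(submK le_m) mdegD leq_addl.
have d2 : (mdeg (m - k0)%MM < (mdeg m).+1)%N by rewrite ltnS mdegB.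
rewrite (bigD1 (BMultinom d1, BMultinom d2)) /=; last by rewrite addmC submK.
rewrite big1 ?addr0 // => -[x y] /= /andP[/eqP mE neq].
apply: fg0 => //; apply: contra neq => /eqP xE.
rewrite xpair_eqE; apply/andP; split; apply/eqP/val_inj => //=.
by move: (congr1 (fun l => l - k0)%MM mE); rewrite -xE (addmC (x : 'X_{1..n})) addmK.
Qed.

(** For [f] a series in [z_i] alone and [g] a series free of [z_i], the exponent
    [m] splits into its [i]-th part and the rest. *)
Lemma fps_coefM_separated (i : 'I_n) f g m :
    (forall k : 'X_{1..n}, k != (U_(i) *+ k i)%MM -> f k = 0) ->
    (forall l : 'X_{1..n}, l i != 0%N -> g l = 0) ->
  (f * g) m = f (U_(i) *+ m i)%MM * g (m - U_(i) *+ m i)%MM.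
Proof.
move=> f0 g0; apply: fps_coefM_unique => [|k l mE].
  apply/mnm_lepP => j; rewrite mulmnE mnm1E.
  by case: eqP => [->|_]; rewrite ?mul1n.
have [li|/g0->] := eqVneq (l i) 0%N; last by rewrite mulr0.
by rewrite mE mnmDE li addn0 => /f0->; rewrite mul0r.
Qed.

End Coefficients.

Lemma sum_nat_trunc (V : zmodType) (F : nat -> V) d e :
    (d <= e)%N -> (forall k, (d <= k)%N -> F k = 0) ->
  \sum_(0 <= k < e) F k = \sum_(0 <= k < d) F k.
Proof.
move=> de F0; rewrite (big_cat_nat (n := d)) //= [X in _ + X]big_nat.
by rewrite [X in _ + X]big1 ?addr0 // => k /andP[/F0].
Qed.

Definition fps_map n (A B : nzRingType) (g : A -> B) (f : fps n A) : fps n B :=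
  fun m => g (f m).

(** * Ordered products of exponentials *)

Section Exponential.
Context {F : fieldType} {n : nat}.
Hypothesis F0 : [pchar F] =i pred0.

Lemma natr_fact_neq0 k : k`!%:R != 0 :> F.
Proof. by rewrite (pcharf0P F).1 // -lt0n fact_gt0. Qed.

Section OneAlgebra.
Context {A : algType F}.
Implicit Types (f g : fps n A) (m : 'X_{1..n}).

(** The cut of the exponential series can be moved to any [D > |m|]; a cut that
    does not depend on [m] is what allows sums to be exchanged. *)
Lemma fps_exp_trunc f m D : f 0%MM = 0 -> (mdeg m < D)%N ->
  fps_exp f m = \sum_(0 <= a < D) (a`!%:R^-1 : F) *: (f ^+ a) m.
Proof.
move=> f0 mD; rewrite (sum_nat_trunc mD) // => a ma.
by rewrite fps_vanishX ?scaler0.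
Qed.

Lemma fps_exp_coefM f g m : f 0%MM = 0 -> g 0%MM = 0 ->
  (fps_exp f * fps_exp g) m =
  \sum_(0 <= b < (mdeg m).+1) \sum_(0 <= a < (mdeg m).+1)
     (a`!%:R^-1 * b`!%:R^-1 : F) *: (f ^+ a * g ^+ b) m.
Proof.
set D := (mdeg m).+1 => f0 g0.
rewrite fps_coefM; transitivity (\sum_(k : 'X_{1..n < D, D} | m == (k.1 + k.2)%MM)
  \sum_(0 <= b < D) \sum_(0 <= a < D)
    (a`!%:R^-1 * b`!%:R^-1 : F) *: ((f ^+ a) k.1 * (g ^+ b) k.2)).
  apply: eq_bigr => -[x y] /= _.
  rewrite !(@fps_exp_trunc _ _ D) ?bmdeg // mulr_sumr; apply: eq_bigr => b _.
  rewrite mulr_suml; apply: eq_bigr => a _.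
  by rewrite -scalerAl -scalerAr scalerA.
rewrite exchange_big; apply: eq_bigr => b _.
rewrite exchange_big; apply: eq_bigr => a _.
by rewrite fps_coefM scaler_sumr.
Qed.

(** Both sides are sums of [f ^+ a * g ^+ b / (a! b!)]: over the triangle
    [a + b < D] on the left by the binomial formula, over the square
    [a, b < D] on the right.  The remaining terms of the square have
    [a + b > |m|], so they do not reach degree [|m|]. *)
Lemma fps_expD f g : f 0%MM = 0 -> g 0%MM = 0 -> GRing.comm f g ->
  fps_exp (f + g) = fps_exp f * fps_exp g.
Proof.
move=> f0 g0 fg; apply/funext => m; rewrite fps_exp_coefM //.
set D := (mdeg m).+1; pose c a b : F := a`!%:R^-1 * b`!%:R^-1.
transitivity (\sum_(0 <= k < D) \sum_(0 <= b < D | (b <= k)%N)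
    c (k - b)%N b *: (f ^+ (k - b) * g ^+ b) m).
  apply: eq_big_nat => k /andP[_ kD].
  rewrite exprDn_comm // fps_coef_sum scaler_sumr.
  (* 'C(k, b) / k! = 1 / ((k - b)! b!) *)
  rewrite -(big_mkord xpredT
    (fun b => k`!%:R^-1 *: ((f ^+ (k - b) * g ^+ b *+ 'C(k, b)) m : A))).
  rewrite (big_nat_widen _ _ D) //; apply: eq_big => // b /=; rewrite ltnS => bk.
  rewrite fps_coefMn -scaler_nat scalerA; congr (_ *: _).
  have := natr_fact_neq0 k; rewrite /c -(bin_fact bk) !natrM !mulf_eq0 !negb_or.
  by case/and3P=> ? ? ?; rewrite !invfM mulrAC mulVf // mul1r mulrC.
rewrite (exchange_big_dep_nat xpredT) //=; apply: eq_big_nat => b /andP[_ bD].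
(* For a fixed b, shift the index to a = k - b, which runs up to D - b. *)
rewrite -(big_nat_widenl b 0 D xpredT) // -{1}[b]add0n big_addn.
rewrite [RHS](@sum_nat_trunc _ _ (D - b)) ?leq_subr // => [|a ab].
  by apply: eq_bigr => a _; rewrite addnK.
rewrite (fps_vanishM (fps_vanishX f0) (fps_vanishX g0)) ?scaler0 //.
by rewrite addnC -leq_subLR.
Qed.

(** The law of exponents in both orders already gives commutation. *)
Lemma fps_exp_comm f g : f 0%MM = 0 -> g 0%MM = 0 ->
  GRing.comm f g -> GRing.comm (fps_exp f) (fps_exp g).
Proof.
by move=> f0 g0 fg; rewrite /GRing.comm -!fps_expD 1?addrC //; apply: commr_sym.
Qed.

Lemma fps_monom0 (x : A) (i : 'I_n) : fps_monom x i 0%MM = 0.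
Proof. by rewrite /fps_monom eq_sym mnm1_eq0. Qed.

Lemma fps_monomX (x : A) (i : 'I_n) k m :
  (fps_monom x i ^+ k) m = if m == (U_(i) *+ k)%MM then x ^+ k else 0.
Proof.
elim: k m => [|k IH] m.
  by rewrite !expr0 mulm0n /GRing.one /= /fps_one; case: eqP.
rewrite exprS mulmS.
have [le_m|nle_m] := boolP (U_(i) <= m)%MM; last first.
  rewrite ifN; last by apply: contraNneq nle_m => ->; apply: lem_addr.
  rewrite fps_coefM big1 // => -[k1 k2] /= /eqP mE.
  rewrite [fps_monom _ _ _]ifN ?mul0r //; apply: contraNneq nle_m => k1E.
  by rewrite mE k1E; apply: lem_addr.
rewrite (fps_coefM_unique le_m) => [|k1 k2 _ /negPf k1E]; last first.
  by rewrite [fps_monom _ _ _]ifN ?k1E // mul0r.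
have -> : (m == (U_(i) + U_(i) *+ k)%MM) = ((m - U_(i))%MM == (U_(i) *+ k)%MM).
  by apply/eqP/eqP => [->|<-]; rewrite addmC ?addmK ?submK.
by rewrite IH [fps_monom _ _ _]ifT //; case: eqP; rewrite ?mulr0 // exprS.
Qed.

Lemma fps_exp_monom (x : A) (i : 'I_n) m :
  fps_exp (fps_monom x i) m =
  if m == (U_(i) *+ m i)%MM then ((m i)`!%:R^-1 : F) *: x ^+ m i else 0.
Proof.
rewrite /fps_exp; have [mE|mE] := eqVneq m (U_(i) *+ m i)%MM; last first.
  apply: big1_seq => k _; rewrite fps_monomX ifN ?scaler0 //.
  apply: contraNneq mE => mk; rewrite {2}mk.
  by rewrite mulmnE mnm1E eqxx mul1n -mk.
have mi : mdeg m = m i by rewrite {1}mE mdegMn mdeg1 mul1n.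
rewrite mi big_nat_recr //= fps_monomX -mE eqxx big_nat big1 ?add0r // => k /andP[_ ki].
rewrite fps_monomX ifN ?scaler0 //; apply: contraTneq ki => mk.
by rewrite -mi mk mdegMn mdeg1 mul1n ltnn.
Qed.

(** The product over a part [s] of the variables, for which the induction
    goes through: distinct factors involve distinct variables, so each exponent
    arises in exactly one way. *)
Lemma fps_prod_exp_monom (x : 'I_n -> A) (s : seq 'I_n) m : uniq s ->
  (\prod_(i <- s) fps_exp (fps_monom (x i) i)) m =
  if [forall i, (i \in s) || (m i == 0)%N]
  then ((\prod_(i <- s) (m i)`!)%:R^-1 : F) *: \prod_(i <- s) x i ^+ m i else 0.
Proof.
elim: s m => [|i s IH] m /=.
  rewrite !big_nil invr1 scale1r /GRing.one /= /fps_one; case: eqP => [->|m0].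
    by case: forallP => // -[] i; rewrite mnm0E.
  by case: forallP => // m0'; case: m0; apply/mnmP => i; rewrite mnm0E; apply/eqP/m0'.
case/andP=> i_s uniq_s; rewrite !big_cons (@fps_coefM_separated _ _ i).
- rewrite fps_exp_monom IH // mulmnE mnm1E eqxx mul1n eqxx.
  have mj (j : 'I_n) : (m - U_(i) *+ m i)%MM j = if j == i then 0%N else m j.
    rewrite mnmBE mulmnE mnm1E eq_sym; case: eqP => [->|_]; first by rewrite mul1n subnn.
    by rewrite mul0n subn0.
  have -> : [forall j, (j \in s) || ((m - U_(i) *+ m i)%MM j == 0%N)] =
            [forall j, (j \in i :: s) || (m j == 0%N)].
    apply: eq_forallb => j; rewrite mj inE; case: (eqVneq j i) => //= _.
    by rewrite eqxx orbT.
  case: ifP => _; last by rewrite mulr0.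
  rewrite -scalerAl -scalerAr scalerA natrM invfM.
  have js_i j : j \in s -> (m - U_(i) *+ m i)%MM j = m j.
    by move=> js; rewrite mj; case: eqP js i_s => // -> ->.
  by congr ((_ * _%:R^-1) *: (_ * _)); apply: eq_big_seq => j /js_i ->.
- by move=> k kE; rewrite fps_exp_monom ifN.
move=> l li; rewrite IH // ifF //; apply/forallP => /(_ i).
by rewrite (negPf i_s) (negPf li).
Qed.

(** The product is not commutative: the order of the [x i] is that of the
    index set. *)
Definition fps_oexp (x : 'I_n -> A) : fps n A :=
  \prod_(i < n) fps_exp (fps_monom (x i) i).

Lemma fps_oexp_coef (x : 'I_n -> A) m :
  fps_oexp x m = ((\prod_(i < n) (m i)`!)%:R^-1 : F) *: \prod_(i < n) x i ^+ m i.
Proof.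
rewrite /fps_oexp fps_prod_exp_monom ?index_enum_uniq // ifT //.
by apply/forallP => i; rewrite mem_index_enum.
Qed.

Lemma fps_oexp0 : fps_oexp (fun=> 0) = 1.
Proof.
apply: big1 => i _; apply/funext => m.
have -> : fps_monom (0 : A) i = 0 by apply/funext => k; rewrite /fps_monom if_same.
rewrite /fps_exp big_nat_recl // big1 => [|k _]; first by rewrite addr0 invr1 scale1r.
by rewrite exprS mul0r scaler0.
Qed.

Lemma fps_monomD (x y : A) (i : 'I_n) :
  fps_monom (x + y) i = fps_monom x i + fps_monom y i.
Proof.
apply/funext => m; rewrite /fps_monom /GRing.add /= /fps_add.
by case: eqP; rewrite ?addr0.
Qed.

(** Split every factor by the law of exponents, then move the factors in the
    [y j] to the right across those in the [x i]. *)
Lemma fps_oexpD (x y : 'I_n -> A) : (forall i j, GRing.comm (x i) (y j)) ->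
  fps_oexp (fun i => x i + y i) = fps_oexp x * fps_oexp y.
Proof.
move=> xy; have xyM i j : GRing.comm (fps_monom (x i) i) (fps_monom (y j) j).
  apply: fps_comm => k l; rewrite /fps_monom.
  by do 2!case: eqP => _ //; first [apply: commr0 | apply/commr_sym/commr0].
rewrite /fps_oexp -prodrM_comm => [|i j _ _]; last first.
  by apply: fps_exp_comm; rewrite ?fps_monom0.
by apply: eq_bigr => i _; rewrite fps_monomD fps_expD ?fps_monom0.
Qed.

End OneAlgebra.

Lemma fps_map_oexp (A B : algType F) (g : {lrmorphism A -> B}) (x : 'I_n -> A) :
  fps_map g (fps_oexp x) = fps_oexp (g \o x).
Proof.
apply/funext => m; rewrite /fps_map !fps_oexp_coef linearZ /= (rmorph_prod g).
by congr (_ *: _); apply: eq_bigr => i _; rewrite rmorphXn.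
Qed.

End Exponential.

(** * The concatenation map on power series *)

Section Concatenation.
Context {F : fieldType} {A : algType F} (S : unshuffle_system A).
Local Notation U := (us_alg S).
Local Notation phi := (us_phi S).
Local Notation iota := (us_iota S).

(** The elements [u] living on the copies below [k] have this property, which
    is linear in [u]; it thus replaces the description of such [u] as sums of
    elementary tensors.  All later factors are quantified over, so that the
    property survives multiplication by the next copy. *)
Definition concatenates (k : nat) (u : U) := forall (l : nat) (X : nat -> A),
  phi (u * \prod_(k <= j < l) iota j (X j)) = phi u * \prod_(k <= j < l) X j.

Lemma concatenates1 : concatenates 0 1.
Proof.
have phiE l (X : nat -> A) :
    phi (\prod_(0 <= j < l) iota j (X j)) = \prod_(0 <= j < l) X j.
  by rewrite !big_mkord; apply: (us_phi_concat S (fun j : 'I_l => X j)).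
move=> l X; have := phiE 0 X; rewrite !big_nil => ->.
by rewrite !mul1r phiE.
Qed.

Lemma concatenates_sum k I (r : seq I) (P : pred I) (u : I -> U) :
    (forall i, P i -> concatenates k (u i)) ->
  concatenates k (\sum_(i <- r | P i) u i).
Proof.
move=> uk l X; rewrite mulr_suml !linear_sum mulr_suml.
by apply: eq_bigr => i /uk ->.
Qed.

Lemma concatenates_phiM k u y :
  concatenates k u -> phi (u * iota k y) = phi u * y.
Proof. by move/(_ k.+1 (fun=> y)); rewrite !big_nat1. Qed.

Lemma concatenatesM k u y :
  concatenates k u -> concatenates k.+1 (u * iota k y).
Proof.
move=> uk l X; have [lk|kl] := leqP l k.
  by rewrite !big_geq ?mulr1 // ltnW.
have := uk l (fun j => if j == k then y else X j).
rewrite !(big_ltn kl) eqxx concatenates_phiM // !mulrA => uE.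
have XE j : (k.+1 <= j < l)%N -> (if j == k then y else X j) = X j.
  by case/andP=> kj _; rewrite gtn_eqF.
rewrite -(eq_big_nat _ _ XE) -uE; congr (phi (_ * _)).
by apply: eq_big_nat => j /XE ->.
Qed.

(** Every coefficient of the product of the first [N] images is a sum of
    products of elements of the successive copies, so the concatenation map
    takes multiplication by the next image of [G] to multiplication by [G]. *)
Lemma fps_map_concat n (G : fps n A) N :
  fps_map phi (\prod_(j < N) fps_map (iota j) G) = G ^+ N.
Proof.
pose H N := \prod_(j < N) fps_map (iota j) G; rewrite -/(H N).
have HS k : H k.+1 = H k * fps_map (iota k) G by rewrite /H big_ord_recr.
have Hk k m : concatenates k (H k m).
  elim: k m => [|k IH] m.
    rewrite /H big_ord0 /GRing.one /= /fps_one; case: eqP => _.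
      exact: concatenates1.
    by move=> l X; rewrite mul0r !linear0 mul0r.
  by rewrite HS fps_coefM; apply: concatenates_sum => z _; apply: concatenatesM.
elim: N => [|N IH]; apply/funext => m.
  rewrite /H big_ord0 expr0 /fps_map /GRing.one /= /fps_one.
  case: eqP => _; last exact: linear0.
  have := us_phi_concat S (fun _ : 'I_0 => 0); rewrite !big_ord0; apply.
rewrite HS exprSr -IH /fps_map !fps_coefM linear_sum.
by apply: eq_bigr => k _; rewrite concatenates_phiM.
Qed.

(** * Moments of repeated arguments *)

Lemma prod_repeat_args (V : nzRingType) n (p : 'X_{1..n}) (a : 'I_n -> A) (f : A -> V) :
  \prod_(k < (\sum_(i < n) p i)%N) f (tnth (repeat_args p a) k) =
  \prod_(i < n) f (a i) ^+ p i.
Proof.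
rewrite -(big_tuple _ _ (repeat_args p a) xpredT) /= /repeat_seq big_flatten big_map.
rewrite enumT [index_enum _]unlock.
by apply: eq_bigr => i _; rewrite big_nseq; elim: (p i) => //= k ->; rewrite exprS.
Qed.

(** The moments of [N] copies are, up to the factorials, the coefficients of
    the [N]-th power of [e^(z_1 a_1) ... e^(z_n a_n)]. *)
Lemma dot_moment_repeat n (p : 'X_{1..n}) (a : 'I_n -> A) N :
    [pchar F] =i pred0 ->
  dot_moment S N (repeat_args p a) =
  ((\prod_(i < n) (p i)`!)%:R : F) *: (fps_oexp a ^+ N) p.
Proof.
move=> F0; pose b N i : U := \sum_(j < N) iota j (a i).
have bE : fps_oexp (b N) = \prod_(j < N) fps_map (iota j) (fps_oexp a).
  elim: N => [|N IH].
    rewrite big_ord0 -[RHS](@fps_oexp0 F).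
    by congr fps_oexp; apply/funext => i; rewrite /b big_ord0.
  rewrite big_ord_recr /= -IH fps_map_oexp -fps_oexpD // => [|i j].
    by congr fps_oexp; apply/funext => i; rewrite /b big_ord_recr.
  apply: commr_sym; apply: commr_sum => l _; apply: (us_tensor S).1.
  by rewrite gtn_eqF.
rewrite -fps_map_concat -bE /fps_map fps_oexp_coef linearZ scalerA.
rewrite mulfV ?scale1r; last first.
  rewrite natr_prod; apply/prodf_neq0 => i _; exact: natr_fact_neq0.
rewrite /dot_moment; congr (phi _).
exact: (@prod_repeat_args U n p a (fun x => \sum_(i < N) iota i x)).
Qed.

End Concatenation.

(** * The linear coefficient of a Newton expansion *)

Section NewtonExpansion.
Context {F : fieldType}.
Hypothesis F0 : [pchar F] =i pred0.

(** [X (X - 1) ... (X - k + 1)], that is, [k!] times the polynomial ['C(X, k)]. *)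
Definition ffact_poly k : {poly F} := \prod_(i < k) ('X - i%:R%:P).

Lemma horner_ffact_poly k N : (ffact_poly k).[N%:R] = (N ^_ k)%:R.
Proof.
elim: k => [|k IH]; first by rewrite /ffact_poly big_ord0 hornerC.
rewrite /ffact_poly big_ord_recr hornerM IH hornerXsubC ffactnSr natrM.
have [kN|Nk] := leqP k N; first by rewrite natrB.
by rewrite ffact_small // !mul0r.
Qed.

Lemma coef1_ffact_poly k : (ffact_poly k.+1)`_1 = (-1) ^+ k * k`!%:R.
Proof.
(* Divide by 'X: what is left is the value at 0 of (X - 1) ... (X - k). *)
rewrite /ffact_poly big_ord_recl subr0 coefXM /= -horner_coef0 horner_prod.
elim: k => [|k IH]; first by rewrite big_ord0 mulr1.
rewrite big_ord_recr IH /= hornerXsubC sub0r factS natrM exprS.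
by rewrite mulrN mulN1r mulNr -mulrA (mulrC k`!%:R).
Qed.

Variable A : algType F.

(** [A] may have zero divisors, so roots cannot simply be counted.  But a linear
    factor at a natural number [c] can be split off, and at [N > c] it takes the
    value [N - c], an invertible scalar, so the quotient vanishes at every
    [N > c]. *)
Lemma poly_nat_eq0 (p : {poly A}) : (forall N : nat, p.[N%:R] = 0) -> p = 0.
Proof.
move=> p0; have {p0}: exists c : nat, forall N, (c <= N)%N -> p.[N%:R] = 0.
  by exists 0%N => N _.
have [d] := ubnP (size p); elim: d p => [//|d IH] p pd [c p0].
have /factor_theorem[q pE] : root p c%:R by apply/eqP/p0.
have [q0|nz_q] := eqVneq q 0; first by rewrite pE q0 mul0r.
suff q0 : q = 0 by rewrite pE q0 mul0r.
apply: IH => [|].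
  by move: pd; rewrite pE size_Mmonic ?monicXsubC // size_XsubC addn2.
exists c.+1 => N cN; move: (p0 N (ltnW cN)); rewrite pE hornerM_comm.
  rewrite hornerXsubC -natrB ?(ltnW cN) // mulr_natr -scaler_nat => /eqP.
  by rewrite scaler_eq0 (pcharf0P F).1 // subn_eq0 leqNgt cN => /eqP.
by rewrite /comm_poly hornerXsubC -natrB ?(ltnW cN) //; apply: commr_nat.
Qed.

Definition newton_poly (c : nat -> A) D : {poly A} :=
  \sum_(0 <= k < D) c k *: map_poly (in_alg A) (k`!%:R^-1 *: ffact_poly k).

Lemma horner_newton_poly c D N :
  (newton_poly c D).[N%:R] = \sum_(0 <= k < D) c k *+ 'C(N, k).
Proof.
rewrite horner_sum; apply: eq_bigr => k _.
rewrite hornerZ -(rmorph_nat (in_alg A)) horner_map hornerZ horner_ffact_poly.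
by rewrite -bin_ffact natrM mulrCA mulVf ?natr_fact_neq0 // mulr1 rmorph_nat mulr_natr.
Qed.

Lemma coef1_newton_poly c D :
  (newton_poly c D)`_1 =
  \sum_(1 <= k < D) ((-1) ^+ k.-1 / k%:R : F) *: c k.
Proof.
have cE k : (c k *: map_poly (in_alg A) (k`!%:R^-1 *: ffact_poly k))`_1 =
    (k`!%:R^-1 * (ffact_poly k)`_1 : F) *: c k.
  by rewrite coefZ coef_map coefZ /= -scalerAr mulr1.
rewrite coef_sum; under eq_bigr do rewrite cE.
case: D => [|D]; first by rewrite !big_geq.
rewrite big_ltn // /ffact_poly big_ord0 coef1 mulr0 scale0r add0r.
apply: eq_big_nat => -[//|k] _; rewrite coef1_ffact_poly factS natrM invfM.
by rewrite mulrCA divfK ?natr_fact_neq0.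
Qed.

End NewtonExpansion.

(** The binomial formula for [1 + (G - 1)]: the sum stops at [N] because of the
    binomial coefficients, and at [|m|] because [G - 1] has no constant term. *)
Lemma fps_expr_newton n (A : nzRingType) (G : fps n A) N m : G 0%MM = 1 ->
  (G ^+ N) m = \sum_(0 <= k < (mdeg m).+1) ((G - 1) ^+ k) m *+ 'C(N, k).
Proof.
move=> G1; have G10 : (G - 1) 0%MM = 0.
  rewrite /GRing.add /= /fps_add G1 /GRing.opp /= /fps_opp /GRing.one /= /fps_one.
  by rewrite eqxx subrr.
rewrite -{1}(subrK 1 G) exprD1n fps_coef_sum.
under eq_bigr do rewrite fps_coefMn.
rewrite -(big_mkord xpredT (fun k => ((G - 1) ^+ k) m *+ 'C(N, k))).
(* Compare both cuts with a common larger one. *)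
pose E := maxn N.+1 (mdeg m).+1.
rewrite -(@sum_nat_trunc _ _ N.+1 E) ?leq_maxl // => [|k Nk]; last first.
  by rewrite bin_small.
rewrite (@sum_nat_trunc _ _ (mdeg m).+1 E) ?leq_maxr // => k mk.
by rewrite fps_vanishX ?mul0rn.
Qed.

(** The Newton expansion gives both the existence of the moment polynomial,
    without which its choice would be a default value, and its only possible
    value. *)
Lemma cumulant_newton (F : fieldType) (A : algType F) (S : unshuffle_system A)
    (m : nat) (X : m.-tuple A) (c : nat -> A) D :
    [pchar F] =i pred0 ->
    (forall N, dot_moment S N X = \sum_(0 <= k < D) c k *+ 'C(N, k)) ->
  cumulant S X = \sum_(1 <= k < D) ((-1) ^+ k.-1 / k%:R : F) *: c k.
Proof.
move=> F0 XE; rewrite -coef1_newton_poly // /cumulant.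
suff -> : dot_moment_poly S X = newton_poly c D by [].
apply/eqP; rewrite -subr_eq0; apply/eqP/(poly_nat_eq0 F0) => N.
rewrite hornerD hornerN horner_newton_poly // -XE.
suff -> : (dot_moment_poly S X).[N%:R] = dot_moment S N X by rewrite subrr.
rewrite /dot_moment_poly; case: xgetP => [q _ /(_ N)|noP] //.
case: (noP (newton_poly c D)) => N'.
by rewrite horner_newton_poly.
Qed.

Theorem theorem6p6 (R : realType) (A : algType R[i]) (S : unshuffle_system A)
    (n : nat) (a : 'I_n -> A) :
  fps_log (\prod_(i < n) fps_exp (fps_monom (a i) i)) =
  (fun p : 'X_{1..n} =>
     if p == 0%MM then 0
     else ((\prod_(i < n) (p i)`!)%:R^-1 : R[i]) *:
            cumulant S (repeat_args p a)) :> fps n A.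
Proof.
have C0 : [pchar R[i]] =i pred0 := Num.Theory.pchar_num R[i].
rewrite -/(fps_oexp a); set G := fps_oexp a.
have G1 : G 0%MM = 1.
  rewrite /G fps_oexp_coef !big1 ?invr1 ?scale1r // => i _; rewrite mnm0E //.
apply/funext => p; case: eqP => [->|_].
  by rewrite /fps_log mdeg0 big_geq.
(* The coefficients of the Newton expansion in N of the moment at p. *)
pose c k : A := ((\prod_(i < n) (p i)`!)%:R : R[i]) *: ((G - 1) ^+ k) p.
rewrite (@cumulant_newton _ _ _ _ _ c (mdeg p).+1 C0) => [|N]; last first.
  rewrite dot_moment_repeat // fps_expr_newton // scaler_sumr.
  by apply: eq_bigr => k _; rewrite scalerMnr.
rewrite /fps_log scaler_sumr; apply: eq_bigr => k _.
rewrite /c !scalerA [in RHS]mulrAC mulVf ?mul1r //.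
by rewrite natr_prod; apply/prodf_neq0 => i _; apply: natr_fact_neq0.
Qed.
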